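(* Let $(A,\mu_A,\alpha_A)$ and $(B,\mu_B,\alpha_B)$ be Hom-associative algebras over a field $k$ with bijective structure maps $\alpha_A,\alpha_B$, and let $A\,{}_Q\otimes_R B$ be a Hom-L-R-twisted tensor product of $A$ and $B$ afforded by linear maps $R:B\otimes A\to A\otimes B$ and $Q:A\otimes B\to A\otimes B$. Assume that $Q$ is bijective with inverse $Q^{-1}$. Then the map $P:B\otimes A\to A\otimes B$, $P=Q^{-1}\circ R$, is a Hom-twisting map, and $Q$ is an isomorphism of Hom-associative algebras $Q:A\otimes_P B\simeq A\,{}_Q\otimes_R B$.
   Context: Everything is over a field $k$; algebras are not assumed unital. A Hom-associative algebra is a triple $(A,\mu,\alpha)$ with $\mu:A\otimes A\to A$ (written $aa'$) and $\alpha:A\to A$ linear (the structure map) such that $\alpha(aa')=\alpha(a)\alpha(a')$ and $\alpha(a)(a'a'')=(aa')\alpha(a'')$. A morphism $f:(A,\mu_A,\alpha_A)\to(B,\mu_B,\alpha_B)$ is a linear map with $\alpha_B\circ f=f\circ\alpha_A$ and $f(aa')=f(a)f(a')$. Sweedler-type notation: $R(b\otimes a)=a_R\otimes b_R=a_r\otimes b_r$, $Q(a\otimes b)=a_Q\otimes b_Q=a_q\otimes b_q$ (sums implied; different letters denote different applications of the same map). Hom-twisting map: a linear map $P:B\otimes A\to A\otimes B$, $P(b\otimes a)=a_P\otimes b_P=a_p\otimes b_p$, such that for all $a,a'\in A$, $b,b'\in B$: $\alpha_A(a_P)\otimes\alpha_B(b_P)=\alpha_A(a)_P\otimes\alpha_B(b)_P$;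 $(aa')_P\otimes\alpha_B(b)_P=a_Pa'_p\otimes\alpha_B((b_P)_p)$; $\alpha_A(a)_P\otimes(bb')_P=\alpha_A((a_P)_p)\otimes b_pb'_P$. Then $A\otimes_P B$ (the Hom-twisted tensor product) is the Hom-associative algebra $A\otimes B$ with multiplication $(a\otimes b)(a'\otimes b')=aa'_P\otimes b_Pb'$ and structure map $\alpha_A\otimes\alpha_B$. Hom-L-R-twisted tensor product: $R,Q$ are required to satisfy, for all $a,a'\in A$, $b,b'\in B$: (1) $\alpha_A(a_R)\otimes\alpha_B(b_R)=\alpha_A(a)_R\otimes\alpha_B(b)_R$; (2) $\alpha_A(a_Q)\otimes\alpha_B(b_Q)=\alpha_A(a)_Q\otimes\alpha_B(b)_Q$; (3) $(aa')_R\otimes\alpha_B(b)_R=a_Ra'_r\otimes\alpha_B((b_R)_r)$; (4) $\alpha_A(a)_R\otimes(bb')_R=\alpha_A((a_R)_r)\otimes b_rb'_R$; (5) $(aa')_Q\otimes\alpha_B(b)_Q=a_qa'_Q\otimes\alpha_B((b_Q)_q)$; (6) $\alpha_A(a)_Q\otimes(bb')_Q=\alpha_A((a_Q)_q)\otimes b_Qb'_q$; (7) $b_R\otimes(a_R)_Q\otimes b'_Q=b_R\otimes(a_Q)_R\otimes b'_Q$; (8) $a_R\otimes(b_R)_Q\otimes a'_Q=a_R\otimes(b_Q)_R\otimes a'_Q$. Then $A\,{}_Q\otimes_R B$ is the Hom-associative algebra $A\otimes B$ with multiplication $(a\otimes b)(a'\otimes b')=a_Qa'_R\otimes b_Rb'_Q$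 and structure map $\alpha_A\otimes\alpha_B$. *)

(* Defs.v *)
From HB Require Import structures.
From mathcomp Require Import all_boot all_order all_algebra.
From mathcomp Require Import boolp.

Set Implicit Arguments.
Unset Strict Implicit.
Unset Printing Implicit Defensive.

Import GRing.Theory.
Local Open Scope ring_scope.
Local Open Scope quotient_scope.

Lemma linear_raddf (k : fieldType) (V W : lmodType k) (f : V -> W) : linear f ->
  [/\ f 0 = 0, forall x y, f (x + y) = f x + f y &
      forall c x, f (c *: x) = c *: f x].
Proof.
move=> fL.
have f0 : f 0 = 0.
  by have /= := fL (-1) 0 0; rewrite addr0 !scaleN1r oppr0 addNr.
split=> // [x y|c x]; first by have /= := fL 1 x y; rewrite !scale1r.
by have /= := fL c x 0; rewrite f0 !addr0.
Qed.

Definition is_bilinear (k : fieldType) (A B W : lmodType k) (f : A -> B -> W) : Prop :=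
  (forall b, linear (f^~ b)) /\ (forall a, linear (f a)).

(* Tensor product of two arbitrary vector spaces: finite formal sums of pairs
   (a, b), modulo the congruence generated by bilinearity.  No formal
   coefficients are needed, since c(a, b) is represented by (ca, b).  The
   universal property is tsum_linear + tsum_tens + tensor_ext below. *)
Section Tensor.
Variables (k : fieldType) (A B : lmodType k).

Inductive tensor_eq : seq (A * B) -> seq (A * B) -> Prop :=
| tensor_eq_refl s : tensor_eq s s
| tensor_eq_sym s t : tensor_eq s t -> tensor_eq t s
| tensor_eq_trans s t u : tensor_eq s t -> tensor_eq t u -> tensor_eq s u
| tensor_eq_cat s s' t t' :
    tensor_eq s s' -> tensor_eq t t' -> tensor_eq (s ++ t) (s' ++ t')
| tensor_eq_catC s t : tensor_eq (s ++ t) (t ++ s)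
| tensor_eq_0 b : tensor_eq [:: (0, b)] [::]
| tensor_eq_Dl a a' b : tensor_eq [:: (a + a', b)] [:: (a, b); (a', b)]
| tensor_eq_Dr a b b' : tensor_eq [:: (a, b + b')] [:: (a, b); (a, b')]
| tensor_eq_Z c a b : tensor_eq [:: (c *: a, b)] [:: (a, c *: b)].

Definition tensor_eqb : rel (seq (A * B)) := fun s t => `[< tensor_eq s t >].

Lemma tensor_eqb_refl : reflexive tensor_eqb.
Proof. by move=> s; apply/asboolP; exact: tensor_eq_refl. Qed.

Lemma tensor_eqb_sym : symmetric tensor_eqb.
Proof. by move=> s t; apply/asboolP/asboolP; exact: tensor_eq_sym. Qed.

Lemma tensor_eqb_trans : transitive tensor_eqb.
Proof.
by move=> t s u /asboolP st /asboolP tu; apply/asboolP; exact: tensor_eq_trans tu.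
Qed.

Canonical tensor_equiv :=
  EquivRel tensor_eqb tensor_eqb_refl tensor_eqb_sym tensor_eqb_trans.

Definition tensor : Type := {eq_quot tensor_equiv}.
HB.instance Definition _ := Choice.on tensor.
HB.instance Definition _ := Quotient.on tensor.

Implicit Types (x y z : tensor) (s t : seq (A * B)).

Lemma tensor_eqP s t : tensor_eq s t <-> \pi_tensor s = \pi_tensor t.
Proof.
split=> [st|st]; first by apply/(eqmodP tensor_equiv s t)/asboolP.
by apply/asboolP/(eqmodP tensor_equiv s t).
Qed.

Lemma tensor_reprK x : \pi_tensor (repr x) = x.
Proof. exact: reprK. Qed.

Lemma tensor_eq_repr s : tensor_eq (repr (\pi_tensor s)) s.
Proof. by apply/tensor_eqP; rewrite reprK. Qed.

Definition tensor_scale_seq (c : k) s := [seq (c *: p.1, p.2) | p <- s].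

Lemma tensor_eq_scale c s t :
  tensor_eq s t -> tensor_eq (tensor_scale_seq c s) (tensor_scale_seq c t).
Proof.
elim=> {s t}.
- by move=> s; exact: tensor_eq_refl.
- by move=> s t _; exact: tensor_eq_sym.
- by move=> s t u _ st _; exact: tensor_eq_trans.
- move=> s s' t t' _ ss' _ tt'.
  by rewrite /tensor_scale_seq !map_cat; exact: tensor_eq_cat.
- by move=> s t; rewrite /tensor_scale_seq !map_cat; exact: tensor_eq_catC.
- by move=> b /=; rewrite scaler0; exact: tensor_eq_0.
- by move=> a a' b /=; rewrite scalerDr; exact: tensor_eq_Dl.
- by move=> a b b' /=; exact: tensor_eq_Dr.
- by move=> d a b /=; rewrite scalerA mulrC -scalerA; exact: tensor_eq_Z.
Qed.

Definition tensor_add x y := \pi_tensor (repr x ++ repr y).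
Definition tensor_zero := \pi_tensor [::].
Definition tensor_scale c x := \pi_tensor (tensor_scale_seq c (repr x)).
Definition tensor_opp := tensor_scale (-1).

Lemma tensor_addE s t :
  tensor_add (\pi_tensor s) (\pi_tensor t) = \pi_tensor (s ++ t).
Proof.
by apply/tensor_eqP; apply: tensor_eq_cat; exact: tensor_eq_repr.
Qed.

Lemma tensor_scaleE c s :
  tensor_scale c (\pi_tensor s) = \pi_tensor (tensor_scale_seq c s).
Proof. by apply/tensor_eqP; apply: tensor_eq_scale; exact: tensor_eq_repr. Qed.

Lemma tensor_addA : associative tensor_add.
Proof.
move=> x y z; rewrite -[x]tensor_reprK -[y]tensor_reprK -[z]tensor_reprK.
by rewrite !tensor_addE catA.
Qed.

Lemma tensor_addC : commutative tensor_add.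
Proof. by move=> x y; apply/tensor_eqP; exact: tensor_eq_catC. Qed.

Lemma tensor_add0 : left_id tensor_zero tensor_add.
Proof. by move=> x; rewrite -[x]tensor_reprK tensor_addE. Qed.

Lemma tensor_scaleDl x c d :
  tensor_scale (c + d) x = tensor_add (tensor_scale c x) (tensor_scale d x).
Proof.
rewrite -[x]tensor_reprK !tensor_scaleE tensor_addE; apply/tensor_eqP.
elim: (repr x) => [|[a b] s IH] /=; first exact: tensor_eq_refl.
rewrite scalerDl.
apply: (@tensor_eq_trans _ ([:: (c *: a, b); (d *: a, b)] ++
   (tensor_scale_seq c s ++ tensor_scale_seq d s))).
  by apply: (@tensor_eq_cat [:: _]) => //; exact: tensor_eq_Dl.
apply: (@tensor_eq_cat [:: _] [:: _]); first exact: tensor_eq_refl.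
rewrite -cat_rcons -cats1; apply: (@tensor_eq_cat (_ :: _)).
  exact: (tensor_eq_catC [:: _]).
exact: tensor_eq_refl.
Qed.

Lemma tensor_scaleA c d x :
  tensor_scale c (tensor_scale d x) = tensor_scale (c * d) x.
Proof.
rewrite -[x]tensor_reprK !tensor_scaleE /tensor_scale_seq -map_comp; congr (\pi_tensor _).
by apply: eq_map => p /=; rewrite scalerA.
Qed.

Lemma tensor_scale1 : left_id 1 tensor_scale.
Proof.
move=> x; rewrite -[x]tensor_reprK tensor_scaleE; congr (\pi_tensor _).
by rewrite -[RHS]map_id; apply: eq_map => -[a b] /=; rewrite scale1r.
Qed.

Lemma tensor_scaleDr : right_distributive tensor_scale tensor_add.
Proof.
move=> c x y; rewrite -[x]tensor_reprK -[y]tensor_reprK !(tensor_scaleE, tensor_addE).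
by rewrite /tensor_scale_seq map_cat.
Qed.

Lemma tensor_scale0 x : tensor_scale 0 x = tensor_zero.
Proof.
rewrite -[x]tensor_reprK tensor_scaleE; apply/tensor_eqP.
elim: (repr x) => [|[a b] s IH] /=; first exact: tensor_eq_refl.
rewrite scale0r; apply: (@tensor_eq_cat [:: _] [::]) => //; exact: tensor_eq_0.
Qed.

Lemma tensor_addN : left_inverse tensor_zero tensor_opp tensor_add.
Proof.
move=> x; rewrite -{2}(tensor_scale1 x) -tensor_scaleDl addNr.
exact: tensor_scale0.
Qed.

HB.instance Definition _ := GRing.isZmodule.Build tensor
  tensor_addA tensor_addC tensor_add0 tensor_addN.
HB.instance Definition _ := GRing.Zmodule_isLmodule.Build k tensor
  tensor_scaleA tensor_scale1 tensor_scaleDr tensor_scaleDl.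

Definition tens (a : A) (b : B) : tensor := \pi_tensor [:: (a, b)].

Lemma tensor_addE_scale c s t :
  c *: \pi_tensor s + \pi_tensor t = \pi_tensor (tensor_scale_seq c s ++ t).
Proof.
by rewrite -tensor_addE -tensor_scaleE.
Qed.

Lemma tens_bilinear : is_bilinear tens.
Proof.
split=> [b|a] c u v; rewrite /tens [RHS]tensor_addE_scale; apply/tensor_eqP.
  exact: tensor_eq_Dl.
apply: tensor_eq_trans (tensor_eq_Dr _ _ _) _; apply: (@tensor_eq_cat [:: _] [:: _]).
  exact/tensor_eq_sym/tensor_eq_Z.
exact: tensor_eq_refl.
Qed.

(* Sweedler sum: tsum f (\sum_i a_i ⊗ b_i) = \sum_i f a_i b_i for bilinear f.
   It is computed on a chosen representative of t; by tsum_linear and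
   tsum_tens the choice is irrelevant as soon as f is bilinear, which is the
   case at every use below. *)
Definition tsum (W : zmodType) (f : A -> B -> W) (x : tensor) : W :=
  \sum_(p <- repr x) f p.1 p.2.

Lemma tensor_repr_sum x : x = \sum_(p <- repr x) tens p.1 p.2.
Proof.
rewrite -{1}[x]tensor_reprK; elim: (repr x) => [|[a b] s IH]; first by rewrite big_nil.
rewrite big_cons -IH /=.
by have := tensor_addE_scale 1 [:: (a, b)] s; rewrite /= !scale1r => <-.
Qed.

Lemma tsum_eq (W : lmodType k) (f : A -> B -> W) s t :
  is_bilinear f -> tensor_eq s t ->
  \sum_(p <- s) f p.1 p.2 = \sum_(p <- t) f p.1 p.2.
Proof.
move=> [fl fr]; elim=> {s t} //=.
- by move=> s t u _ -> _ ->.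
- by move=> s s' t t' _ ss' _ tt'; rewrite !big_cat /= ss' tt'.
- by move=> s t; rewrite !big_cat /= addrC.
- by move=> b; rewrite big_seq1 big_nil /=; have [->] := linear_raddf (fl b).
- move=> a a' b; rewrite !big_cons !big_nil /= !addr0.
  by have [_ ->] := linear_raddf (fl b).
- move=> a b b'; rewrite !big_cons !big_nil /= !addr0.
  by have [_ ->] := linear_raddf (fr a).
- move=> c a b; rewrite !big_seq1 /=.
  by have [_ _ ->] := linear_raddf (fl b); have [_ _ ->] := linear_raddf (fr a).
Qed.

Lemma tsum_linear (W : lmodType k) (f : A -> B -> W) :
  is_bilinear f -> linear (tsum f).
Proof.
move=> fB c x y; rewrite /tsum scaler_sumr.
rewrite (tsum_eq (t := tensor_scale_seq c (repr x) ++ repr y) fB); last first.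
  by apply/tensor_eqP; rewrite !tensor_reprK -tensor_addE_scale !tensor_reprK.
rewrite big_cat big_map /=; congr (_ + _); apply: eq_bigr => p _.
have [fl _] := fB.
by have [_ _ ->] := linear_raddf (fl p.2).
Qed.

Lemma tsum_tens (W : lmodType k) (f : A -> B -> W) a b :
  is_bilinear f -> tsum f (tens a b) = f a b.
Proof.
move=> fB; rewrite /tsum (tsum_eq (t := [:: (a, b)]) fB) ?big_seq1 //.
exact: tensor_eq_repr.
Qed.

End Tensor.

Notation "a ⊗ b" := (tens a b) (at level 40, left associativity) : ring_scope.
Notation "\tsum_ ( a , b <- t ) F" := (tsum (fun a b => F) t)
  (at level 41, a name, b name, t at level 200, F at level 41,
   format "'[' \tsum_ ( a ,  b  <-  t ) '/  '  F ']'") : ring_scope.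

Section TensorTheory.
Variable k : fieldType.
Implicit Types A B V W : lmodType k.

Lemma tensor_ext A B W (f g : tensor A B -> W) :
  linear f -> linear g -> (forall a b, f (a ⊗ b) = g (a ⊗ b)) -> f =1 g.
Proof.
move=> fL gL fg x; rewrite (tensor_repr_sum x).
have [f0 fD _] := linear_raddf fL; have [g0 gD _] := linear_raddf gL.
rewrite (big_morph f fD f0) (big_morph g gD g0).
by apply: eq_bigr => p _; exact: fg.
Qed.

Lemma linear_tsum A B V W (L : V -> W) (f : A -> B -> V) t :
  linear L -> L (tsum f t) = \tsum_(a, b <- t) L (f a b).
Proof.
move=> LL; rewrite /tsum; have [L0 LD _] := linear_raddf LL.
by rewrite (big_morph L LD L0).
Qed.

Lemma tsum_linear_fun A B V W (f : V -> A -> B -> W) t :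
  (forall a b, linear (fun x => f x a b)) ->
  linear (fun x => \tsum_(a, b <- t) f x a b).
Proof.
move=> fL c x y; rewrite /tsum scaler_sumr -big_split /=.
by apply: eq_bigr => p _; exact: fL.
Qed.

Lemma tsum_linear_arg A B V W (f : A -> B -> W) (g : V -> tensor A B) :
  is_bilinear f -> linear g -> linear (fun x => tsum f (g x)).
Proof. by move=> fB gL c x y; rewrite gL tsum_linear. Qed.

Lemma linear_comp V W V' (f : V -> W) (g : V' -> V) :
  linear f -> linear g -> linear (fun x => f (g x)).
Proof. by move=> fL gL c x y; rewrite gL fL. Qed.

Lemma tens_linearl A B V (f : V -> A) (b : B) :
  linear f -> linear (fun x => f x ⊗ b).
Proof. by move=> fL c x y; rewrite fL; have [-> _] := tens_bilinear A B. Qed.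

Lemma tens_linearr A B V (f : V -> B) (a : A) :
  linear f -> linear (fun x => a ⊗ f x).
Proof. by move=> fL c x y; rewrite fL; have [_ ->] := tens_bilinear A B. Qed.

Lemma tsum_id A B (t : tensor A B) : \tsum_(a, b <- t) a ⊗ b = t.
Proof. by rewrite [RHS]tensor_repr_sum. Qed.

Lemma exchange_tsum A B A' B' W (f : A -> B -> A' -> B' -> W) t t' :
  \tsum_(a, b <- t) \tsum_(a', b' <- t') f a b a' b' =
  \tsum_(a', b' <- t') \tsum_(a, b <- t) f a b a' b'.
Proof. by rewrite /tsum exchange_big. Qed.

Lemma eq_tsum A B W (f g : A -> B -> W) t :
  (forall a b, f a b = g a b) -> tsum f t = tsum g t.
Proof. by move=> fg; apply: eq_bigr => p _; exact: fg. Qed.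

End TensorTheory.

(* Proves linearity in one variable of an iterated Sweedler sum. *)
Ltac lin :=
  cbv beta;
  lazymatch goal with
  | |- is_bilinear _ => split=> ?; lin
  | |- GRing.linear_for _ ?F =>
    lazymatch F with
    | fun x => x => by []
    | fun x => tens _ _ =>
        first [apply tens_linearl; lin | apply tens_linearr; lin]
    | fun x => tsum _ _ =>
        first [apply tsum_linear_fun; intros; lin | apply tsum_linear_arg; lin]
    | tens _ => exact: (proj2 (tens_bilinear _ _))
    | _ =>
        first [by []
              | lazymatch F with
                | fun x => _ _ => eapply linear_comp; [by [] | lin]
                end]
    end
  end.

Record homAssocAlg (k : fieldType) := HomAssocAlg {
  carrier :> lmodType k;
  hmul : tensor carrier carrier -> carrier;
  halpha : carrier -> carrier;
  hmul_linear : linear hmul;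
  halpha_linear : linear halpha;
  halpha_mul : forall a a', halpha (hmul (a ⊗ a')) = hmul (halpha a ⊗ halpha a');
  hom_assoc : forall a a' a'',
    hmul (halpha a ⊗ hmul (a' ⊗ a'')) = hmul (hmul (a ⊗ a') ⊗ halpha a'')
}.
Arguments hmul {k h} _.
Arguments halpha {k h} _.

Notation "a ⋅ b" := (hmul (a ⊗ b)) (at level 40, left associativity) : ring_scope.
Notation α := halpha.

Section HomAssociative.
Variable k : fieldType.
Implicit Types A B C : homAssocAlg k.

Record is_hom_morphism A B (f : A -> B) : Prop := IsHomMorphism {
  hom_morphism_linear : linear f;
  hom_morphism_alpha : forall a, α (f a) = f (α a);
  hom_morphism_mul : forall a a', f (a ⋅ a') = f a ⋅ f a'
}.

Definition is_hom_isomorphism A B (f : A -> B) : Prop :=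
  is_hom_morphism f /\
  exists g : B -> A, [/\ is_hom_morphism g, cancel f g & cancel g f].

Record is_hom_twisting A B (P : tensor B A -> tensor A B) : Prop := IsHomTwisting {
  twisting_linear : linear P;
  twisting_alpha : forall a b,
    \tsum_(aP, bP <- P (b ⊗ a)) α aP ⊗ α bP = P (α b ⊗ α a);
  twisting_mull : forall a a' b,
    P (α b ⊗ (a ⋅ a')) =
    \tsum_(aP, bP <- P (b ⊗ a)) \tsum_(a'p, bPp <- P (bP ⊗ a'))
      ((aP ⋅ a'p) ⊗ α bPp);
  twisting_mulr : forall a b b',
    P ((b ⋅ b') ⊗ α a) =
    \tsum_(aP, b'P <- P (b' ⊗ a)) \tsum_(aPp, bp <- P (b ⊗ aP))
      (α aPp ⊗ (bp ⋅ b'P))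
}.

Record is_hom_LR_twisting A B (R : tensor B A -> tensor A B)
    (Q : tensor A B -> tensor A B) : Prop := IsHomLRTwisting {
  LR_R_linear : linear R;
  LR_Q_linear : linear Q;
  LR_R_alpha : forall a b,
    \tsum_(aR, bR <- R (b ⊗ a)) α aR ⊗ α bR = R (α b ⊗ α a);
  LR_Q_alpha : forall a b,
    \tsum_(aQ, bQ <- Q (a ⊗ b)) α aQ ⊗ α bQ = Q (α a ⊗ α b);
  LR_R_mull : forall a a' b,
    R (α b ⊗ (a ⋅ a')) =
    \tsum_(aR, bR <- R (b ⊗ a)) \tsum_(a'r, bRr <- R (bR ⊗ a'))
      ((aR ⋅ a'r) ⊗ α bRr);
  LR_R_mulr : forall a b b',
    R ((b ⋅ b') ⊗ α a) =
    \tsum_(aR, b'R <- R (b' ⊗ a)) \tsum_(aRr, br <- R (b ⊗ aR))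
      (α aRr ⊗ (br ⋅ b'R));
  LR_Q_mull : forall a a' b,
    Q ((a ⋅ a') ⊗ α b) =
    \tsum_(a'Q, bQ <- Q (a' ⊗ b)) \tsum_(aq, bQq <- Q (a ⊗ bQ))
      ((aq ⋅ a'Q) ⊗ α bQq);
  LR_Q_mulr : forall a b b',
    Q (α a ⊗ (b ⋅ b')) =
    \tsum_(aQ, bQ <- Q (a ⊗ b)) \tsum_(aQq, b'q <- Q (aQ ⊗ b'))
      (α aQq ⊗ (bQ ⋅ b'q));
  (* b_R ⊗ (a_R)_Q ⊗ b'_Q = b_R ⊗ (a_Q)_R ⊗ b'_Q, bracketed in B ⊗ (A ⊗ B) *)
  LR_QR_A : forall a b b',
    \tsum_(aR, bR <- R (b ⊗ a)) \tsum_(aRQ, b'Q <- Q (aR ⊗ b'))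
      bR ⊗ (aRQ ⊗ b'Q) =
    \tsum_(aQ, b'Q <- Q (a ⊗ b')) \tsum_(aQR, bR <- R (b ⊗ aQ))
      bR ⊗ (aQR ⊗ b'Q);
  (* a_R ⊗ (b_R)_Q ⊗ a'_Q = a_R ⊗ (b_Q)_R ⊗ a'_Q, bracketed in A ⊗ (B ⊗ A) *)
  LR_QR_B : forall a a' b,
    \tsum_(aR, bR <- R (b ⊗ a)) \tsum_(a'Q, bRQ <- Q (a' ⊗ bR))
      aR ⊗ (bRQ ⊗ a'Q) =
    \tsum_(a'Q, bQ <- Q (a' ⊗ b)) \tsum_(aR, bQR <- R (bQ ⊗ a))
      aR ⊗ (bQR ⊗ a'Q)
}.

Definition tensor_alpha A B (x : tensor A B) : tensor A B :=
  \tsum_(a, b <- x) α a ⊗ α b.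

Definition twisted_mul A B (P : tensor B A -> tensor A B)
    (z : tensor (tensor A B) (tensor A B)) : tensor A B :=
  \tsum_(x, y <- z) \tsum_(a, b <- x) \tsum_(a', b' <- y)
    \tsum_(a'P, bP <- P (b ⊗ a')) (a ⋅ a'P) ⊗ (bP ⋅ b').

Definition LR_mul A B (R : tensor B A -> tensor A B) (Q : tensor A B -> tensor A B)
    (z : tensor (tensor A B) (tensor A B)) : tensor A B :=
  \tsum_(x, y <- z) \tsum_(a, b <- x) \tsum_(a', b' <- y)
    \tsum_(aQ, b'Q <- Q (a ⊗ b')) \tsum_(a'R, bR <- R (b ⊗ a'))
      (aQ ⋅ a'R) ⊗ (bR ⋅ b'Q).

Section LRProduct.
Variables (A B : homAssocAlg k) (R : tensor B A -> tensor A B).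
Variables (Q : tensor A B -> tensor A B).
Hypothesis H : is_hom_LR_twisting R Q.

Let hmA := @hmul_linear k A.
Let hmB := @hmul_linear k B.
Let haA := @halpha_linear k A.
Let haB := @halpha_linear k B.
Let RL := LR_R_linear H.
Let QL := LR_Q_linear H.

Lemma tensor_alpha_linear : linear (@tensor_alpha A B).
Proof. rewrite /tensor_alpha; lin. Qed.

Lemma LR_mul_linear : linear (LR_mul R Q).
Proof. rewrite /LR_mul; lin. Qed.

Lemma LR_mulE a b a' b' : LR_mul R Q ((a ⊗ b) ⊗ (a' ⊗ b')) =
  \tsum_(aQ, b'Q <- Q (a ⊗ b')) \tsum_(a'R, bR <- R (b ⊗ a'))
    (aQ ⋅ a'R) ⊗ (bR ⋅ b'Q).
Proof. by rewrite /LR_mul tsum_tens ?tsum_tens //; lin. Qed.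

Lemma tensor_alphaE a b : tensor_alpha (a ⊗ b : tensor A B) = α a ⊗ α b.
Proof. by rewrite /tensor_alpha tsum_tens //; lin. Qed.

Lemma tsum_subst (C D : lmodType k) (W : lmodType k) (t : tensor C D)
    (C1 D1 C2 D2 : lmodType k) (t1 : tensor C1 D1)
    (t2 : C1 -> D1 -> tensor C2 D2) (u : C1 -> D1 -> C2 -> D2 -> C) v
    (f : C -> D -> W) :
  is_bilinear f ->
  t = \tsum_(c1, d1 <- t1) \tsum_(c2, d2 <- t2 c1 d1)
        (u c1 d1 c2 d2 ⊗ v c1 d1 c2 d2) ->
  tsum f t = \tsum_(c1, d1 <- t1) \tsum_(c2, d2 <- t2 c1 d1)
        f (u c1 d1 c2 d2) (v c1 d1 c2 d2).
Proof.
move=> fB ->; rewrite linear_tsum; last exact: tsum_linear.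
apply: eq_tsum => c1 d1; rewrite linear_tsum; last exact: tsum_linear.
by apply: eq_tsum => c2 d2; rewrite tsum_tens.
Qed.

Lemma LR_QR_A_subst (W : lmodType k) (T : B -> A -> B -> W) a b b' :
  (forall y z, linear (fun x => T x y z)) ->
  (forall x z, linear (fun y => T x y z)) ->
  (forall x y, linear (fun z => T x y z)) ->
  \tsum_(aR, bR <- R (b ⊗ a)) \tsum_(aRQ, b'Q <- Q (aR ⊗ b')) T bR aRQ b'Q =
  \tsum_(aQ, b'Q <- Q (a ⊗ b')) \tsum_(aQR, bR <- R (b ⊗ aQ)) T bR aQR b'Q.
Proof.
move=> T1 T2 T3.
have L : linear (fun w : tensor B (tensor A B) =>
    \tsum_(x, yz <- w) \tsum_(y, z <- yz) T x y z) by lin.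
have := congr1 (fun w : tensor B (tensor A B) =>
    \tsum_(x, yz <- w) \tsum_(y, z <- yz) T x y z) (LR_QR_A H a b b').
rewrite /= !(linear_tsum _ _ L) => E.
apply: etrans (etrans E _); [symmetry|]; apply: eq_tsum => x y;
  rewrite (linear_tsum _ _ L); apply: eq_tsum => x' y';
  by rewrite tsum_tens ?tsum_tens //; lin.
Qed.

Lemma LR_QR_B_subst (W : lmodType k) (T : A -> B -> A -> W) a a' b :
  (forall y z, linear (fun x => T x y z)) ->
  (forall x z, linear (fun y => T x y z)) ->
  (forall x y, linear (fun z => T x y z)) ->
  \tsum_(aR, bR <- R (b ⊗ a)) \tsum_(a'Q, bRQ <- Q (a' ⊗ bR)) T aR bRQ a'Q =
  \tsum_(a'Q, bQ <- Q (a' ⊗ b)) \tsum_(aR, bQR <- R (bQ ⊗ a)) T aR bQR a'Q.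
Proof.
move=> T1 T2 T3.
have L : linear (fun w : tensor A (tensor B A) =>
    \tsum_(x, yz <- w) \tsum_(y, z <- yz) T x y z) by lin.
have := congr1 (fun w : tensor A (tensor B A) =>
    \tsum_(x, yz <- w) \tsum_(y, z <- yz) T x y z) (LR_QR_B H a a' b).
rewrite /= !(linear_tsum _ _ L) => E.
apply: etrans (etrans E _); [symmetry|]; apply: eq_tsum => x y;
  rewrite (linear_tsum _ _ L); apply: eq_tsum => x' y';
  by rewrite tsum_tens ?tsum_tens //; lin.
Qed.

Let ML := LR_mul_linear.
Let TL := tensor_alpha_linear.

Lemma LR_alpha_mul (x y : tensor A B) :
  tensor_alpha (LR_mul R Q (x ⊗ y)) =
  LR_mul R Q (tensor_alpha x ⊗ tensor_alpha y).
Proof.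
move: x; apply: tensor_ext; [lin|lin|move=> a b].
move: y; apply: tensor_ext; [lin|lin|move=> a' b'].
rewrite !tensor_alphaE !LR_mulE -(LR_R_alpha H) -(LR_Q_alpha H).
rewrite linear_tsum //; symmetry; rewrite linear_tsum; last by apply: tsum_linear; lin.
apply: eq_tsum => aQ b'Q; rewrite tsum_tens; last by lin.
rewrite !linear_tsum //; last by apply: tsum_linear; lin.
apply: eq_tsum => a'R bR; rewrite tsum_tens; last by lin.
by rewrite tensor_alphaE !halpha_mul.
Qed.

Lemma LR_hom_assoc (x y z : tensor A B) :
  LR_mul R Q (tensor_alpha x ⊗ LR_mul R Q (y ⊗ z)) =
  LR_mul R Q (LR_mul R Q (x ⊗ y) ⊗ tensor_alpha z).
Proof.
move: x; apply: tensor_ext; [lin|lin|move=> a b].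
move: y; apply: tensor_ext; [lin|lin|move=> a' b'].
move: z; apply: tensor_ext; [lin|lin|move=> a'' b''].
rewrite !tensor_alphaE !LR_mulE.
pose G (a2 : A) (s1 s2 : A) (b2 c1 c2 : B) :=
  ((a2 ⋅ s1) ⋅ α s2) ⊗ ((b2 ⋅ c1) ⋅ α c2).
have -> : LR_mul R Q ((α a ⊗ α b) ⊗
      (\tsum_(a'Q, b''Q <- Q (a' ⊗ b'')) \tsum_(a''R, b'R <- R (b' ⊗ a''))
         (a'Q ⋅ a''R) ⊗ (b'R ⋅ b''Q))) =
    \tsum_(a'Q, b''Q <- Q (a' ⊗ b'')) \tsum_(s1, b1 <- R (b ⊗ a'Q))
    \tsum_(a''R, b'R <- R (b' ⊗ a'')) \tsum_(a1, c1 <- Q (a ⊗ b'R))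
    \tsum_(a2, c2 <- Q (a1 ⊗ b''Q)) \tsum_(s2, b2 <- R (b1 ⊗ a''R))
      G a2 s1 s2 b2 c1 c2.
  rewrite (linear_tsum (L := fun y => LR_mul R Q (_ ⊗ y))); last by lin.
  apply: eq_tsum => a'Q b''Q.
  rewrite (linear_tsum (L := fun y => LR_mul R Q (_ ⊗ y))); last by lin.
  rewrite exchange_tsum; apply: eq_tsum => a''R b'R.
  rewrite LR_mulE (tsum_subst _ (LR_Q_mulr H _ _ _)); last by lin.
  rewrite exchange_tsum; apply: eq_tsum => a1 c1.
  rewrite [RHS] exchange_tsum; apply: eq_tsum => a2 c2.
  rewrite (tsum_subst _ (LR_R_mull H _ _ _)); last by lin.
  apply: eq_tsum => s1 b1; apply: eq_tsum => s2 b2.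
  by rewrite !hom_assoc.
rewrite -LR_QR_A_subst; first last.
- by intros u v; rewrite /G; lin.
- by intros u v; rewrite /G; lin.
- by intros u v; rewrite /G; lin.
have -> : LR_mul R Q ((\tsum_(aQ, b'Q <- Q (a ⊗ b')) \tsum_(a'R, bR <- R (b ⊗ a'))
         (aQ ⋅ a'R) ⊗ (bR ⋅ b'Q)) ⊗ (α a'' ⊗ α b'')) =
    \tsum_(a'R, bR <- R (b ⊗ a')) \tsum_(p1, q1 <- Q (a'R ⊗ b''))
    \tsum_(aQ, b'Q <- Q (a ⊗ b')) \tsum_(a1, d1 <- R (b'Q ⊗ a''))
    \tsum_(p2, q2 <- Q (aQ ⊗ q1)) \tsum_(a2, d2 <- R (bR ⊗ a1))
      G p2 p1 a2 d2 d1 q2.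
  rewrite (linear_tsum (L := fun y => LR_mul R Q (y ⊗ _))); last by lin.
  under [RHS]eq_tsum => a'R bR do rewrite exchange_tsum.
  rewrite [RHS]exchange_tsum; apply: eq_tsum => aQ b'Q.
  rewrite (linear_tsum (L := fun y => LR_mul R Q (y ⊗ _))); last by lin.
  apply: eq_tsum => a'R bR.
  rewrite LR_mulE (tsum_subst _ (LR_Q_mull H _ _ _)); last by lin.
  apply: eq_tsum => p1 q1; rewrite exchange_tsum.
  rewrite [LHS]exchange_tsum; under eq_tsum => p2 q2.
    rewrite (tsum_subst _ (LR_R_mulr H _ _ _)); last by lin.
    over.
  by rewrite exchange_tsum.
apply: eq_tsum => a'R bR; apply: eq_tsum => p1 q1.
by apply: LR_QR_B_subst; intros u v; rewrite /G; lin.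
Qed.

Definition LR_tensor : homAssocAlg k :=
  @HomAssocAlg k (tensor A B) (LR_mul R Q) (@tensor_alpha A B) LR_mul_linear
    tensor_alpha_linear LR_alpha_mul LR_hom_assoc.

End LRProduct.

Section TwistedProduct.
Variables (A B : homAssocAlg k) (P : tensor B A -> tensor A B).
Hypothesis H : is_hom_twisting P.

(* A hom-twisting map is the case Q = id of an L-R-twisting pair. *)
Lemma twisting_LR : is_hom_LR_twisting P (@id (tensor A B)).
Proof.
have hmA := @hmul_linear k A; have hmB := @hmul_linear k B.
have haA := @halpha_linear k A; have haB := @halpha_linear k B.
case: H => PL P1 P2 P3; split=> //.
- by move=> a b; rewrite tsum_tens //; lin.
- by move=> a a' b; rewrite tsum_tens ?tsum_tens //; lin.
- by move=> a b b'; rewrite tsum_tens ?tsum_tens //; lin.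
- move=> a b b'; rewrite tsum_tens; last by lin.
  by apply: eq_tsum => a1 b1; rewrite tsum_tens //; lin.
- move=> a a' b; rewrite tsum_tens; last by lin.
  by apply: eq_tsum => a1 b1; rewrite tsum_tens //; lin.
Qed.

Lemma twisted_mulE : twisted_mul P =1 LR_mul P id.
Proof.
have hmA := @hmul_linear k A; have hmB := @hmul_linear k B.
have PL := twisting_linear H.
move=> z; apply: eq_tsum => x y; apply: eq_tsum => a b.
apply: eq_tsum => a' b'; rewrite tsum_tens //; lin.
Qed.

Lemma twisted_mul_linear : linear (twisted_mul P).
Proof. by move=> c x y; rewrite !twisted_mulE (LR_mul_linear twisting_LR). Qed.

Lemma twisted_alpha_mul (x y : tensor A B) :
  tensor_alpha (twisted_mul P (x ⊗ y)) =
  twisted_mul P (tensor_alpha x ⊗ tensor_alpha y).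
Proof. by rewrite !twisted_mulE (LR_alpha_mul twisting_LR). Qed.

Lemma twisted_hom_assoc (x y z : tensor A B) :
  twisted_mul P (tensor_alpha x ⊗ twisted_mul P (y ⊗ z)) =
  twisted_mul P (twisted_mul P (x ⊗ y) ⊗ tensor_alpha z).
Proof. by rewrite !twisted_mulE (LR_hom_assoc twisting_LR). Qed.

Definition twisted_tensor : homAssocAlg k :=
  @HomAssocAlg k (tensor A B) (twisted_mul P) (@tensor_alpha A B) twisted_mul_linear
    (@tensor_alpha_linear A B) twisted_alpha_mul twisted_hom_assoc.

End TwistedProduct.

End HomAssociative.

(* Main.v *)
(** Since [Q P = R], every identity to be proved for [P] becomes, after applying
    the injective map [Q], an identity between iterated applications of [R] and
    [Q].  The axioms (5), (6) move the outer [Q] inside the product, the inner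
    composites [Q P] collapse to [R], and the mixed axioms (7), (8) exchange the
    remaining [Q] and [R].  Multiplicativity of [Q] is checked on tensors of the
    form [α u ⊗ α v], which is where bijectivity of the structure maps enters. *)

Require Import Defs.
From HB Require Import structures.
From mathcomp Require Import all_boot all_order all_algebra.
Local Open Scope ring_scope.

Set Implicit Arguments.

(** Used from right to left: it unfolds a linear map at [P t] into a Sweedler sum over [P t]. *)
Lemma tsum_linearE (k : fieldType) (A B V : lmodType k) (L : tensor A B -> V)
    (x : tensor A B) : linear L -> \tsum_(a, b <- x) L (a ⊗ b) = L x.
Proof. by move=> LL; rewrite -(linear_tsum _ _ LL) tsum_id. Qed.

Lemma can_linear (k : fieldType) (V W : lmodType k) (f : V -> W) (g : W -> V) :
  linear f -> cancel f g -> cancel g f -> linear g.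
Proof. by move=> fL fK gK c x y; apply: (can_inj fK); rewrite fL !gK. Qed.

Lemma can_hom_isomorphism (k : fieldType) (A B : homAssocAlg k)
    (f : A -> B) (g : B -> A) :
  is_hom_morphism f -> cancel f g -> cancel g f -> is_hom_isomorphism f.
Proof.
move=> fH fK gK; split=> //; exists g; split=> //.
case: fH => fL fa fM; split=> [|b|b b'].
- exact: can_linear fK gK.
- by apply: (can_inj fK); rewrite -fa !gK.
- by apply: (can_inj fK); rewrite fM !gK.
Qed.

Lemma LR_Q_tensor_alpha (k : fieldType) (A B : homAssocAlg k)
    (R : tensor B A -> tensor A B) (Q : tensor A B -> tensor A B)
    (hRQ : is_hom_LR_twisting R Q) (x : tensor A B) :
  Q (tensor_alpha x) = tensor_alpha (Q x).
Proof.
have haA := @halpha_linear k A; have haB := @halpha_linear k B.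
have QL := LR_Q_linear hRQ; have TL := @tensor_alpha_linear k A B.
move: x; apply: tensor_ext; [lin|lin|move=> a b].
by rewrite tensor_alphaE -(LR_Q_alpha hRQ).
Qed.

Lemma LR_Qinv_twisting (k : fieldType) (A B : homAssocAlg k)
    (R : tensor B A -> tensor A B) (Q Qinv : tensor A B -> tensor A B)
    (hRQ : is_hom_LR_twisting R Q) (QK : cancel Q Qinv) (QinvK : cancel Qinv Q) :
  is_hom_twisting (Qinv \o R).
Proof.
have hmA := @hmul_linear k A; have hmB := @hmul_linear k B.
have haA := @halpha_linear k A; have haB := @halpha_linear k B.
have RL := LR_R_linear hRQ; have QL := LR_Q_linear hRQ.
have QiL := can_linear QL QK QinvK.
set P := Qinv \o R.
have QP t : Q (P t) = R t by exact: QinvK.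
have PL : linear P by apply: linear_comp.
split=> //.
- move=> a b; apply: (can_inj QK); rewrite QP.
  rewrite -[X in Q X]/(tensor_alpha (P (b ⊗ a))).
  by rewrite (LR_Q_tensor_alpha hRQ) QP -(LR_R_alpha hRQ).
- move=> a a' b; apply: (can_inj QK); rewrite QP (LR_R_mull hRQ) linear_tsum //.
  (* Reading [R] as [Q] after [P] makes both sides sums over [P (b ⊗ a)]. *)
  rewrite -QP -(tsum_linearE (L := fun x => tsum _ (Q x))); last by lin.
  apply: eq_tsum => aP bP; rewrite linear_tsum //.
  (* Moving [R] outside [Q] lets it be split as [Q] after [P] again; the two nested [Q] left are
     those of [LR_Q_mull]. *)
  rewrite -(LR_QR_B_subst hRQ (T := fun x y z => (z ⋅ x) ⊗ α y)); try by move=> *; lin.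
  rewrite -QP -(tsum_linearE (L := fun x => tsum _ (Q x))); last by lin.
  by apply: eq_tsum => a'p bPp; rewrite (LR_Q_mull hRQ).
- move=> a b b'; apply: (can_inj QK); rewrite QP (LR_R_mulr hRQ) linear_tsum //.
  rewrite -QP -(tsum_linearE (L := fun x => tsum _ (Q x))); last by lin.
  apply: eq_tsum => aP b'P; rewrite linear_tsum //.
  rewrite -(LR_QR_A_subst hRQ (T := fun x y z => α y ⊗ (x ⋅ z))); try by move=> *; lin.
  rewrite -QP -(tsum_linearE (L := fun x => tsum _ (Q x))); last by lin.
  by apply: eq_tsum => aPp bp; rewrite (LR_Q_mulr hRQ).
Qed.

Lemma twisted_mul_tensE (k : fieldType) (A B : homAssocAlg k)
    (P : tensor B A -> tensor A B) (hP : is_hom_twisting P) a b a' b' :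
  twisted_mul P ((a ⊗ b) ⊗ (a' ⊗ b')) =
  \tsum_(a'P, bP <- P (b ⊗ a')) (a ⋅ a'P) ⊗ (bP ⋅ b').
Proof.
have hmA := @hmul_linear k A; have hmB := @hmul_linear k B.
have PL := twisting_linear hP.
by rewrite (twisted_mulE hP) (LR_mulE (twisting_LR hP)) tsum_tens //; lin.
Qed.

(** [LR_Q_mull] and [LR_Q_mulr] expand [Q] at a product only if the other tensor factor is an image
    of [α], hence the shape of the arguments. *)
Lemma LR_Q_twisted_mul_alpha (k : fieldType) (A B : homAssocAlg k)
    (R P : tensor B A -> tensor A B) (Q : tensor A B -> tensor A B)
    (hRQ : is_hom_LR_twisting R Q) (hP : is_hom_twisting P)
    (QP : forall t, Q (P t) = R t) a b a' b' :
  Q (twisted_mul P ((α a ⊗ α b) ⊗ (α a' ⊗ α b'))) =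
  LR_mul R Q (Q (α a ⊗ α b) ⊗ Q (α a' ⊗ α b')).
Proof.
have hmA := @hmul_linear k A; have hmB := @hmul_linear k B.
have haA := @halpha_linear k A; have haB := @halpha_linear k B.
have RL := LR_R_linear hRQ; have QL := LR_Q_linear hRQ.
have PL := twisting_linear hP.
have ML := LR_mul_linear hRQ; have TL := @tensor_alpha_linear k A B.
(* This is the left side fully expanded, with the [Q] acting on [P (b ⊗ a')] absorbed into [R]. *)
transitivity (\tsum_(a'R, bR <- R (b ⊗ a')) \tsum_(a'RQ, b'Q <- Q (a'R ⊗ b'))
    \tsum_(aQ, bRQ <- Q (a ⊗ bR)) \tsum_(aQq, b'Qq <- Q (aQ ⊗ b'Q))
      α (aQq ⋅ a'RQ) ⊗ α (bRQ ⋅ b'Qq)).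
  rewrite (twisted_mul_tensE hP) -(twisting_alpha hP).
  rewrite (linear_tsum (L := fun x => Q (tsum _ x))); last first.
    by apply: (linear_comp QL); apply: tsum_linear; lin.
  rewrite -QP -[RHS](tsum_linearE (L := fun x => tsum _ (Q x))); last by lin.
  apply: eq_tsum => a'P bP; rewrite tsum_tens; last by lin.
  (* [α bP ⋅ α b'] is itself an image of [α], so the left factor can be split first. *)
  rewrite -(halpha_mul bP) (LR_Q_mull hRQ) (tsum_subst _ (LR_Q_mulr hRQ _ _ _)); last by lin.
  apply: eq_tsum => a'PQ bPQ; apply: eq_tsum => a'PQq b'q.
  rewrite (tsum_subst _ (LR_Q_mulr hRQ _ _ _)); last by lin.
  by apply: eq_tsum => aQ bPQQ; apply: eq_tsum => aQq b'qq; rewrite -halpha_mul.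
(* The sum over [Q (a' ⊗ b')] comes outermost, matching the second factor of the product on the
   right. *)
rewrite (LR_QR_A_subst hRQ (T := fun x y z => \tsum_(aQ, xQ <- Q (a ⊗ x))
  \tsum_(aQq, zq <- Q (aQ ⊗ z)) α (aQq ⋅ y) ⊗ α (xQ ⋅ zq))); try by move=> *; lin.
rewrite -!tensor_alphaE !(LR_Q_tensor_alpha hRQ) -(LR_alpha_mul hRQ).
rewrite -[in RHS](tsum_id (Q (a' ⊗ b'))).
rewrite (linear_tsum (L := fun y => tensor_alpha (LR_mul R Q (_ ⊗ y)))); last by lin.
apply: eq_tsum => a'Q b'Q.
(* Likewise [Q (a ⊗ b)] is brought out before [R]; the remaining [R] and [Q] are those of
   [LR_mul]. *)
rewrite (LR_QR_B_subst hRQ (T := fun x y z =>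
  \tsum_(zq, b'q <- Q (z ⊗ b'Q)) α (zq ⋅ x) ⊗ α (y ⋅ b'q))); try by move=> *; lin.
rewrite -[in RHS](tsum_id (Q (a ⊗ b))).
rewrite (linear_tsum (L := fun y => tensor_alpha (LR_mul R Q (y ⊗ _)))); last by lin.
apply: eq_tsum => aQ bQ; rewrite exchange_tsum (LR_mulE hRQ) linear_tsum //.
apply: eq_tsum => aQq b'q; rewrite linear_tsum //.
by apply: eq_tsum => a'QR bQR; rewrite tensor_alphaE.
Qed.

Theorem proposition2p4 (k : fieldType) (A B : homAssocAlg k)
    (bijA : bijective (@halpha k A)) (bijB : bijective (@halpha k B))
    (R : tensor B A -> tensor A B) (Q : tensor A B -> tensor A B)
    (hRQ : is_hom_LR_twisting R Q)
    (Qinv : tensor A B -> tensor A B)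
    (QK : cancel Q Qinv) (QinvK : cancel Qinv Q) :
  exists hP : is_hom_twisting (Qinv \o R),
    @is_hom_isomorphism k (twisted_tensor hP) (LR_tensor hRQ) Q.
Proof.
have hP := LR_Qinv_twisting hRQ QK QinvK.
exists hP; apply: (@can_hom_isomorphism _ (twisted_tensor hP) (LR_tensor hRQ) _ _ _ QK QinvK).
have QL := LR_Q_linear hRQ; have ML := LR_mul_linear hRQ.
have PL := twisted_mul_linear hP.
split=> [//|x|x y] /=; first by rewrite (LR_Q_tensor_alpha hRQ).
move: x; apply: tensor_ext; [lin|lin|move=> a b].
move: y; apply: tensor_ext; [lin|lin|move=> a' b'].
have [βA _ αAK] := bijA; have [βB _ αBK] := bijB.
rewrite -(αAK a) -(αBK b) -(αAK a') -(αBK b').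
exact: (LR_Q_twisted_mul_alpha hRQ hP (fun t => QinvK (R t))).
Qed.
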